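(* Let $D$ be a planar strong digraph with $\mathsf{d}_s^-(D)=3$. If $\{S_1,S_2,S_3\}$ is a partition of $V(D)$ into three strong in-dominating sets, then for each $i\in\{1,2,3\}$ the induced subdigraph $D\langle S_i\rangle$ is a symmetric path.
   Context: Digraphs are finite, loopless, without parallel arcs. A digraph is strong if for every ordered pair $u,v$ there is a directed $uv$-walk. $D$ is planar if its underlying simple graph is planar. $S\subseteq V(D)$ is in-dominating if every vertex not in $S$ has an out-neighbor in $S$; strong in-dominating if moreover $D\langle S\rangle$ is strong. $\mathsf{d}_s^-(D)$ is the maximum number of classes of a partition of $V(D)$ into strong in-dominating sets. A symmetric path is a digraph obtained from an undirected path (possibly with one vertex) by replacing each edge $uv$ by both arcs $(u,v)$ and $(v,u)$. *)

(* Defs.v *)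
(* MathComp; MathComp-Analysis, used only for drawings in the plane, is
   imported further down because it shadows [partition] and the finite-set
   notations. *)
From HB Require Import structures.
From mathcomp Require Import all_boot all_order all_algebra.

Set Implicit Arguments.
Unset Strict Implicit.
Unset Printing Implicit Defensive.

Record digraph := Digraph {
  vertex :> finType;
  arc : rel vertex;
  arc_irrefl : irreflexive arc }.

Record sgraph := SGraph {
  svertex :> finType;
  edge : rel svertex;
  edge_sym : symmetric edge;
  edge_irrefl : irreflexive edge }.

Section Underlying.
Variable D : digraph.
Definition underlying_edge : rel D := fun u v => arc u v || arc v u.
Fact underlying_edge_sym : symmetric underlying_edge.
Proof. by move=> u v; rewrite /underlying_edge orbC. Qed.
Fact underlying_edge_irrefl : irreflexive underlying_edge.
Proof. by move=> u; rewrite /underlying_edge arc_irrefl. Qed.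
Definition underlying : sgraph :=
  SGraph underlying_edge_sym underlying_edge_irrefl.
End Underlying.

Section Induced.
Variables (D : digraph) (S : {set D}).
Definition induced_arc : rel {x : D | x \in S} :=
  fun u v => arc (val u) (val v).
Fact induced_arc_irrefl : irreflexive induced_arc.
Proof. by move=> u; apply: arc_irrefl. Qed.
Definition induced : digraph := Digraph induced_arc_irrefl.
End Induced.

Definition strong (D : digraph) : bool :=
  [forall u : D, forall v : D, connect (@arc D) u v].

Definition in_dominating (D : digraph) (S : {set D}) : bool :=
  [forall u : D, (u \notin S) ==> [exists v in S, arc u v]].

Definition strong_in_dominating (D : digraph) (S : {set D}) : bool :=
  in_dominating S && strong (induced S).

(* [partition] already excludes empty classes. *)
Definition strong_in_dominating_partition (D : digraph) (P : {set {set D}}) :=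
  partition P [set: D] && [forall S in P, strong_in_dominating S].

Definition ds_in (D : digraph) : nat :=
  \max_(P : {set {set D}} | strong_in_dominating_partition P) #|P|.

Definition digraph_iso (D E : digraph) : Prop :=
  exists2 f : D -> E, bijective f & forall u v, arc (f u) (f v) = arc u v.

(* [edge], read as an arc relation, contains both orientations of every edge. *)
Definition symmetric_digraph (G : sgraph) : digraph :=
  Digraph (@edge_irrefl G).

Section PathGraph.
Variable n : nat.
Definition path_edge : rel 'I_n :=
  fun i j => (i.+1 == j :> nat) || (j.+1 == i :> nat).
Fact path_edge_sym : symmetric path_edge.
Proof. by move=> i j; rewrite /path_edge orbC. Qed.
Fact path_edge_irrefl : irreflexive path_edge.
Proof. by move=> i; rewrite /path_edge orbb gtn_eqF. Qed.
Definition path_graph : sgraph := SGraph path_edge_sym path_edge_irrefl.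
End PathGraph.

Definition symmetric_path (D : digraph) : Prop :=
  exists n : nat, digraph_iso D (symmetric_digraph (path_graph n.+1)).

From mathcomp Require Import all_classical all_reals all_analysis.

Import Order.TTheory GRing.Theory Num.Theory.
Import numFieldNormedType.Exports.

Section Planarity.
Variable R : realType.
Local Open Scope ring_scope.
Local Open Scope classical_set_scope.

Definition plane_arc (a b : R * R) (A : set (R * R)) : Prop :=
  exists g : R -> R * R,
    [/\ {within `[0, 1], continuous g},
        {in `[0, 1] &, injective g},
        g 0 = a, g 1 = b
      & A = g @` `[0, 1]].

(* [E u v] is the curve that draws the edge uv; its values on non-adjacent
   pairs are irrelevant. *)
Definition plane_drawing (G : sgraph) (p : G -> R * R)
    (E : G -> G -> set (R * R)) : Prop :=
  [/\ injective p,
      forall u v, edge u v -> plane_arc (p u) (p v) (E u v),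
      forall u v, edge u v -> E u v = E v u,
      forall u v w, edge u v -> ~ (E u v `\` [set p u; p v]) (p w)
    & forall u v x y, edge u v -> edge x y ->
        ([set u; v] != [set x; y])%SET ->
        (E u v `\` [set p u; p v]) `&` E x y = set0].

Definition planar (G : sgraph) : Prop :=
  exists (p : G -> R * R) (E : G -> G -> set (R * R)), plane_drawing p E.

Definition planar_digraph (D : digraph) : Prop := planar (underlying D).
End Planarity.

(* Main.v *)
(* A class S_i that is not a path contains a claw or a cycle.  The two other
   classes are connected, adjacent to each other and to every vertex of S_i, so
   that a claw yields a K33 minor and a cycle a K5 minor.  Hence S_i is a path,
   and a strong digraph whose underlying graph is a path is symmetric.

   The nonplanarity of these minors is van Kampen's parity argument, made
   discrete.  Two disjoint edges of the minor are drawn within disjoint unions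
   of branch sets, hence on disjoint compact sets; replace the curves by
   sequences of points with steps much smaller than the distances between
   these sets.  Counting modulo 2 how often such a sequence meets the ray to
   the right of each vertex gives one linear relation per pair of disjoint
   edges, and over all pairs the relations of K5, or of K33, add up to 1 = 0. *)
Require Import Defs.
From mathcomp Require Import all_boot.
From mathcomp Require Import reals.
From mathcomp Require all_order all_algebra lra.
From mathcomp Require all_classical all_reals all_analysis.
From Stdlib Require Ring.

Set Implicit Arguments.
Unset Strict Implicit.
Unset Printing Implicit Defensive.

(** * Mod 2 crossings of discrete walks *)

Section Crossing.
Variables (T : eqType) (h X : rel T).
Hypotheses (h_anti : forall a b, a != b -> h b a = ~~ h a b)
           (X_anti : forall a b, a != b -> X b a = ~~ X a b).

(* Reading [h p q] as "p is below q" and [X p q] as "p is right of q", [ray]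
   counts the steps of a walk that meet the horizontal ray going right from a
   point, and [coray] those that meet the ray going left. *)
Definition ray_step a b q := (h a q (+) h b q) && X a q.
Definition coray_step p a b := (h p a (+) h p b) && X p a.

Fixpoint ray a s q :=
  if s is b :: s' then ray_step a b q (+) ray b s' q else false.
Fixpoint coray p a s :=
  if s is b :: s' then coray_step p a b (+) coray p b s' else false.

(* Both sides count the crossings with the horizontal line through p. *)
Lemma ray_coray p a s : p \notin a :: s ->
  ray a s p (+) coray p a s = h p a (+) h p (last a s).
Proof.
elim: s a => [|b s IH] a /=; first by rewrite addbb.
rewrite inE negb_or => /andP[pa pbs].
have pb : p != b by apply: contraNneq pbs => ->; apply: mem_head.
have := IH b pbs.
rewrite /ray_step /coray_step !(h_anti pa) (h_anti pb) (X_anti pa).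
by move: (h p a) (h p (last b s)) (h p b) (X p a) (ray _ _ _) (coray _ _ _);
  do 6![case].
Qed.

Variables near far : rel T.
(* Two short steps that are far apart are separated horizontally or
   vertically. *)
Hypothesis near_far : forall a b q q', near a b -> near q q' ->
  far a q -> far a q' -> far b q -> far b q' ->
  X a q' = X a q /\ X b q = X a q \/
  [/\ h a q' = h a q, h b q = h a q & h b q' = h a q].

Lemma step_uncrossed a b q t : near a b -> path near q t ->
  {in q :: t, forall y, far a y && far b y} ->
  ray_step a b q (+) ray_step a b (last q t)
    = coray a q t (+) coray b q t.
Proof.
move=> ab; elim: t q => [|q' t IH] q /=; first by rewrite addbb.
move=> /andP[qq' q't] fart.
have /andP[aq bq] := fart q (mem_head _ _).
have q'in : q' \in q :: q' :: t by rewrite !inE eqxx orbT.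
have /andP[aq' bq'] := fart q' q'in.
have := IH _ q't (fun y yt => fart y (@mem_behead _ (q :: q' :: t) y yt)).
have := near_far ab qq' aq aq' bq bq'.
rewrite /ray_step /coray_step.
move: (coray a _ _) (coray b _ _) (h a (last _ _)) (h b (last _ _))
  (X a (last _ _)) => c d u v x.
case=> [[-> ->] | [-> -> ->]].
  by move: (h a q) (h a q') (h b q) (h b q') (X a q) c d u v x; do 10![case].
by move: (h a q) (X a q) (X a q') (X b q) c d u v x; do 9![case].
Qed.

(** Summing [step_uncrossed] over the steps of [s] telescopes: the left rays from interior points of
    the first walk are counted twice. *)
Lemma walks_uncrossed a s q t : path near a s -> path near q t ->
  {in a :: s & q :: t, forall x y, far x y} ->
  ray a s q (+) ray a s (last q t) = coray a q t (+) coray (last a s) q t.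
Proof.
move=> + qt; elim: s a => [|b s IH] a /=; first by rewrite addbb.
move=> /andP[ab bs] fars.
have := IH b bs (fun x y xs => fars x y (@mem_behead _ (a :: b :: s) x xs)).
have : {in q :: t, forall y, far a y && far b y}.
  by move=> y yt; rewrite !fars // !inE eqxx ?orbT.
move/(step_uncrossed ab qt).
by move: (ray_step _ _ _) (ray_step _ _ q) (coray a _ _) (coray b _ _)
  (ray _ _ _) (ray _ _ q) (coray (last _ _) _ _); do 7![case].
Qed.

Hypothesis far_irr : irreflexive far.

(** [ray_coray], applied at the ends [a] and [b] of the first walk, trades the left rays of
    [walks_uncrossed] for right rays and order terms. What is left depends on a walk only through
    its crossings with the right rays from ends of the other, which is what can be summed over a
    whole graph. *)
Lemma independent_walks a s q t (b := last a s) (r := last q t) :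
  path near a s -> path near q t ->
  {in a :: s & q :: t, forall x y, far x y} ->
  ray a s q (+) ray a s r (+) ray q t a (+) ray q t b
    (+) h a q (+) h a r (+) h b q (+) h b r = false.
Proof.
move=> sP tP far_st; have := walks_uncrossed sP tP far_st.
have notin x : x \in a :: s -> x \notin q :: t.
  by move=> xs; apply/negP => /(far_st _ _ xs); rewrite far_irr.
have := ray_coray (notin _ (mem_head _ _)).
have := ray_coray (notin _ (mem_last _ _)).
rewrite -/b -/r.
by move: (ray a s q) (ray a s r) (ray q t a) (ray q t b)
  (coray a _ _) (coray b _ _) (h a q) (h a r) (h b q) (h b r); do 10![case].
Qed.
End Crossing.

Section Parity.
Import Stdlib.setoid_ring.Ring.

(** The ring structure on [bool] known to [ring] has [xorb] as its addition. *)
Let addb_xorb a b : a (+) b = xorb a b. Proof. by case: a. Qed.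

(* In the sum over the 15 pairs of disjoint edges every [r] cancels, and so does
   every [h] once [h b a] is rewritten as [~~ h a b] for a < b; what remains is
   the parity of the number of negations, i.e. of the number of crossings of K5
   drawn with its vertices in convex position. *)
Lemma K5_parity (r : nat -> nat -> nat -> bool) (h : rel nat) :
  (forall a b, a < 5 -> b < 5 -> a != b -> h b a = ~~ h a b) ->
  ~ (forall a b c d, [&& a < b < 5, c < d < 5 & uniq [:: a; b; c; d]] ->
     r a b c (+) r a b d (+) r c d a (+) r c d b
       (+) h a c (+) h a d (+) h b c (+) h b d = false).
Proof.
move=> h_anti E; suff: false = true by [].
have hh a b : a < b < 5 -> h b a = true (+) h a b.
  by case/andP=> ab bn; rewrite h_anti ?(ltn_trans ab) ?ltn_eqF // addTb.
have := congr2 addb (congr2 addb (congr2 addb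
  (congr2 addb (E 0 1 2 3 isT) (congr2 addb (E 0 2 1 3 isT) (E 0 3 1 2 isT)))
  (congr2 addb (E 0 1 2 4 isT) (congr2 addb (E 0 2 1 4 isT) (E 0 4 1 2 isT))))
  (congr2 addb
    (congr2 addb (E 0 1 3 4 isT) (congr2 addb (E 0 3 1 4 isT) (E 0 4 1 3 isT)))
    (congr2 addb (E 0 2 3 4 isT) (congr2 addb (E 0 3 2 4 isT) (E 0 4 2 3 isT)))))
  (congr2 addb (E 1 2 3 4 isT) (congr2 addb (E 1 3 2 4 isT) (E 1 4 2 3 isT))).
rewrite !(hh 1 2, hh 1 3, hh 1 4, hh 2 3, hh 2 4, hh 3 4) //.
by rewrite !addb_xorb => parity; apply: etrans (esym parity) _; ring.
Qed.

(** The same cancellation over the 18 pairs of disjoint edges between {0,1,2} and {3,4,5}. With 0,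
    ..., 5 in convex position in this order, exactly 9 of these pairs cross, an odd number. *)
Lemma K33_parity (r : nat -> nat -> nat -> bool) (h : rel nat) :
  (forall a b, a < 6 -> b < 6 -> a != b -> h b a = ~~ h a b) ->
  ~ (forall a b c d,
       [&& a < 3 <= b, b < 6, c < 3 <= d, d < 6 & uniq [:: a; b; c; d]] ->
     r a b c (+) r a b d (+) r c d a (+) r c d b
       (+) h a c (+) h a d (+) h b c (+) h b d = false).
Proof.
move=> h_anti E; suff: false = true by [].
have hh a b : a < b < 6 -> h b a = true (+) h a b.
  by case/andP=> ab bn; rewrite h_anti ?(ltn_trans ab) ?ltn_eqF // addTb.
have := congr2 addb (congr2 addb
  (congr2 addb (congr2 addb (E 0 3 1 4 isT) (E 0 4 1 3 isT)) (congr2 addb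
    (congr2 addb (E 0 3 1 5 isT) (E 0 5 1 3 isT))
      (congr2 addb (E 0 4 1 5 isT) (E 0 5 1 4 isT))))
  (congr2 addb (congr2 addb (E 0 3 2 4 isT) (E 0 4 2 3 isT)) (congr2 addb
    (congr2 addb (E 0 3 2 5 isT) (E 0 5 2 3 isT))
      (congr2 addb (E 0 4 2 5 isT) (E 0 5 2 4 isT)))))
  (congr2 addb (congr2 addb (E 1 3 2 4 isT) (E 1 4 2 3 isT)) (congr2 addb
    (congr2 addb (E 1 3 2 5 isT) (E 1 5 2 3 isT))
      (congr2 addb (E 1 4 2 5 isT) (E 1 5 2 4 isT)))).
rewrite !(hh 1 3, hh 1 4, hh 1 5, hh 2 3, hh 2 4, hh 2 5) //.
rewrite !(hh 3 4, hh 3 5, hh 4 5) //.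
by rewrite !addb_xorb => parity; apply: etrans (esym parity) _; ring.
Qed.
End Parity.

(** * Drawings in the plane *)

Section Plane.
Import all_order all_algebra all_classical all_reals all_analysis lra Defs.
Import Order.TTheory GRing.Theory Num.Theory.
Import numFieldNormedType.Exports.
Variable R : realType.
Local Open Scope ring_scope.
Local Open Scope classical_set_scope.
Implicit Types (p q : R * R) (A B : set (R * R)) (e : R).

(* Ties are broken by the other coordinate, so that any two distinct points are
   comparable and no general position is needed. *)
Definition below p q := (p.2 < q.2) || ((p.2 == q.2) && (p.1 < q.1)).
Definition right_of p q := (q.1 < p.1) || ((q.1 == p.1) && (q.2 < p.2)).

Lemma below_anti p q : p != q -> below q p = ~~ below p q.
Proof.
case: p q => [a b] [c d]; rewrite /below xpair_eqE /=.
by case: (ltgtP b d); case: (ltgtP a c).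
Qed.

Lemma right_of_anti p q : p != q -> right_of q p = ~~ right_of p q.
Proof.
case: p q => [a b] [c d]; rewrite /right_of xpair_eqE /=.
by case: (ltgtP b d); case: (ltgtP a c).
Qed.

Definition nearby e p q := (`|p.1 - q.1| < e) && (`|p.2 - q.2| < e).

Lemma nearbyP e p q : reflect (ball p e q) (nearby e p q).
Proof. exact: andP. Qed.

(** Points at least [3 * e] apart in some coordinate keep their order in that coordinate when each
    of them moves by less than [e]; this is what [nearby_apart] rests on. *)
Definition apart e p q := ~~ nearby (3%:R * e) p q.

Lemma apart_irr e : 0 < e -> irreflexive (apart e).
Proof. by move=> e0 p; rewrite /apart /nearby !subrr normr0 mulr_gt0. Qed.

Lemma nearby_apart e a b p q : nearby e a b -> nearby e p q ->
  apart e a p -> apart e a q -> apart e b p -> apart e b q ->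
  right_of a q = right_of a p /\ right_of b p = right_of a p \/
  [/\ below a q = below a p, below b p = below a p & below b q = below a p].
Proof.
move=> /andP[ab1 ab2] /andP[pq1 pq2] + _ _ _.
rewrite /apart negb_and -!leNgt.
have lt_neq (x y : R) :
    x < y -> [/\ y < x = false, (x == y) = false & (y == x) = false].
  by move=> xy; rewrite (lt_gtF xy) (lt_eqF xy) (gt_eqF xy).
move: ab1 ab2 pq1 pq2; rewrite !ltr_norml.
move=> /andP[? ?] /andP[? ?] /andP[? ?] /andP[? ?].
rewrite /right_of /below !ler_normr; case/orP=> [/orP[]|/orP[]] far.
- left; have [-> -> ->] // : [/\ p.1 < a.1, q.1 < a.1 & p.1 < b.1] by split; lra.
- left; have [/lt_neq[-> _ ->] /lt_neq[-> _ ->] /lt_neq[-> _ ->]] // :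
    [/\ a.1 < p.1, a.1 < q.1 & b.1 < p.1] by split; lra.
- right.
  have [/lt_neq[-> _ ->] /lt_neq[-> _ ->] /lt_neq[-> _ ->] /lt_neq[-> _ ->]] // :
    [/\ p.2 < a.2, q.2 < a.2, p.2 < b.2 & q.2 < b.2] by split; lra.
- right; have [-> -> -> ->] // :
    [/\ a.2 < p.2, a.2 < q.2, b.2 < p.2 & b.2 < q.2] by split; lra.
Qed.

Definition chain e A p q :=
  exists s,
    [/\ path (nearby e) p s, last p s = q & forall x, x \in p :: s -> A x].

Lemma chain_refl e A p : A p -> chain e A p p.
Proof. by exists [::]; split=> // x; rewrite inE => /eqP->. Qed.

Lemma chain_cat e A p q r : chain e A p q -> chain e A q r -> chain e A p r.
Proof.
move=> [s [ps <- sA]] [t [qt <- tA]]; exists (s ++ t).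
rewrite cat_path last_cat ps qt; split=> // x.
rewrite -cat_cons mem_cat => /orP[/sA //|xt].
by apply: tA; rewrite inE xt orbT.
Qed.

Lemma chain_sub e A B p q : A `<=` B -> chain e A p q -> chain e B p q.
Proof. by move=> AB [s [? ? sA]]; exists s; split=> // x /sA/AB. Qed.

Lemma chain_step e A p q : A p -> A q -> nearby e p q -> chain e A p q.
Proof.
move=> Ap Aq pq; exists [:: q]; split=> //= [|x]; first by rewrite pq.
by rewrite !inE => /orP[]/eqP->.
Qed.

(** The points of [A] that chains reach from [p] form a nonempty subset which is both open and
    closed relative to [A]. *)
Lemma connected_chain e A p q :
  0 < e -> connected A -> A p -> A q -> chain e A p q.
Proof.
move=> e0 conA Ap Aq; pose B := [set x | A x /\ chain e A p x].
suff BA : B = A by move: Aq; rewrite -{1}BA => -[].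
have chain_ball x y :
    A x -> A y -> chain e A p x -> ball x e y -> chain e A p y.
  by move=> Ax Ay px /nearbyP xy; apply: chain_cat px _; apply: chain_step.
apply: conA; first by exists p; split=> //; apply: chain_refl.
- exists (\bigcup_(x in B) (ball x e)^°).
    by apply: bigcup_open => x _; exact: open_interior.
  apply/seteqP; split=> [x [Ax px]|x [Ax [y [Ay py] /interior_subset yx]]].
    split=> //; exists x; first by [].
    exact: nbhsx_ballx.
  by split=> //; apply: chain_ball yx.
(* A ball of radius [e] around an unreached point of [A] contains no reached point, since one more
   step would reach its centre. *)
- exists (~` \bigcup_(x in A `\` B) (ball x e)^°).
    by apply/open_closedC/bigcup_open => x _; exact: open_interior.
  apply/seteqP; split=> [x [Ax px]|x [Ax nx]].
    split=> // -[y [Ay By] /interior_subset yx]; apply: By; split=> //.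
    by apply: chain_ball (ball_sym yx).
  apply: contrapT => Bx; apply: nx; exists x; first by [].
  exact: nbhsx_ballx.
Qed.

(** Each point of [A] has a neighbourhood on which all small [e] work, because [B] is closed;
    compactness of [A], in near-covering form, makes the threshold uniform. *)
Lemma compact_apart A B : compact A -> compact B -> A `&` B = set0 ->
  \forall e \near 0^'+, forall x y, A x -> B y -> apart e x y.
Proof.
move=> cA cB AB0.
have clB : closed B by apply: compact_closed => //; exact: norm_hausdorff.
have /compact_near_coveringP cov := cA.
suff : \forall e \near (0 : R)^'+, A `<=` [set x | forall y, B y -> apart e x y].
  by apply: filterS => e eP x y Ax; apply: eP.
apply: cov => x Ax.
have : nbhs x (~` B).
  apply: open_nbhs_nbhs; split; first exact: closed_openC.
  by move=> Bx; have : (A `&` B) x by []; rewrite AB0.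
move=> /nbhs_ballP[d /= d0 dB].
(* For [e < d / 6], a point of [B] within [3 * e] of a point of the half-radius ball would lie
   within [d] of [x]. *)
exists (ball x (d / 2), [set e | e < d / 6]) => /=.
  split; first by apply: nbhsx_ballx; rewrite divr_gt0.
  by apply: nbhs_right_lt; rewrite divr_gt0.
move=> [x' e] /= [xx' ed] y By; apply/negP => /nearbyP x'y; apply: dB By.
rewrite [d]splitr; apply: ball_triangle xx' (le_ball _ x'y).
lra.
Qed.
End Plane.

Section Drawing.
Import all_order all_algebra all_classical all_reals all_analysis Defs.
Import Order.TTheory GRing.Theory Num.Theory.
Import numFieldNormedType.Exports.
Variables (R : realType) (G : sgraph).
Variables (p : G -> R * R) (E : G -> G -> set (R * R)).
Hypothesis drawn : plane_drawing p E.
Local Open Scope ring_scope.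
Local Open Scope classical_set_scope.

Lemma edge_curve u v : edge u v ->
  [/\ compact (E u v), connected (E u v), E u v (p u) & E u v (p v)].
Proof.
case: drawn => _ /(_ u v) + _ _ _ => /[apply] -[g [gC _ g0 g1 ->]].
have in0 : (`[0, 1] : set R) 0 by rewrite /= in_itv /= lexx ler01.
have in1 : (`[0, 1] : set R) 1 by rewrite /= in_itv /= lexx ler01.
split; first by apply: continuous_compact => //; exact: segment_compact.
- by apply: connected_continuous_connected => //; exact: segment_connected.
- by exists 0.
- by exists 1.
Qed.

Lemma curves_disjoint u v x y : edge u v -> edge x y -> uniq [:: u; v; x; y] ->
  E u v `&` E x y = set0.
Proof.
case: drawn => p_inj _ _ nov nocross uv xy /=; rewrite !inE !negb_or.
move=> /and4P[/and3P[_ ux uy] /andP[vx vy] _ _].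
have mid : ([set u; v] != [set x; y])%SET.
  apply: contra_neq ux => /setP/(_ u).
  by rewrite !inE eqxx /= (negPf uy) orbF => /esym/eqP.
rewrite -subset0 => z [zuv zxy].
have [zu|zu] := pselect (z = p u \/ z = p v); last first.
  by rewrite -(nocross _ _ _ _ uv xy mid).
(* A common point at an end of the first curve is a vertex lying on the second curve; there it can
   only be an end, against injectivity of [p]. *)
case: zu zuv zxy => -> _ wxy.
- apply: (nov _ _ u xy); split=> // -[] /p_inj; exact/eqP.
- apply: (nov _ _ v xy); split=> // -[] /p_inj; exact/eqP.
Qed.

(** There are finitely many quadruples of vertices, and [compact_apart] holds for all small [e], so
    one [e] serves every pair of disjoint edges. *)
Lemma curves_apart : exists2 e : R, 0 < e &
  forall u v x y, edge u v -> edge x y -> uniq [:: u; v; x; y] ->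
  forall a b, E u v a -> E x y b -> apart e a b.
Proof.
have near0 (i : G * G * G * G) : \forall e \near (0 : R)^'+,
  edge i.1.1.1 i.1.1.2 -> edge i.1.2 i.2 ->
  uniq [:: i.1.1.1; i.1.1.2; i.1.2; i.2] ->
  forall a b, E i.1.1.1 i.1.1.2 a -> E i.1.2 i.2 b -> apart e a b.
  case: i => [[[u v] x] y] /=.
  have [uv|] := boolP (edge u v); last by move=> _; near=> e.
  have [xy|] := boolP (edge x y); last by move=> _; near=> e.
  have [U|nU] := boolP (uniq [:: u; v; x; y]); last first.
    by near=> e => _ _ U; case/negP: nU.
  have [cuv _ _ _] := edge_curve uv; have [cxy _ _ _] := edge_curve xy.
  apply: filterS (compact_apart cuv cxy (curves_disjoint uv xy U)).
  by move=> e eP _ _ _.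
have := filterI (nbhs_right_gt (0 : R)) (filter_forall _ near0).
move=> /(_ _ _)/filter_ex[e [e0 eP]].
by exists e => // u v x y; apply: (eP (u, v, x, y)).
Unshelve. all: by end_near.
Qed.

Definition drawn_on (U : {set G}) : set (R * R) :=
  [set z | exists x y, [/\ edge x y, x \in U, y \in U & E x y z]].

Lemma drawn_on_apart e (U W : {set G}) :
  (forall u v x y, edge u v -> edge x y -> uniq [:: u; v; x; y] ->
    forall a b, E u v a -> E x y b -> apart e a b) ->
  {in U, forall x, x \notin W} ->
  forall a b, drawn_on U a -> drawn_on W b -> apart e a b.
Proof.
move=> eP dUW a b [u [v [uv uU vU ua]]] [x [y [xy xW yW ya]]].
apply: (eP _ _ _ _ uv xy _ _ _ ua ya); rewrite /= !inE !negb_or.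
have neq (s t : G) : s \in U -> t \in W -> s != t.
  by move=> sU tW; apply: contraTneq tW => <-; apply: dUW.
have edge_neq (s t : G) : edge s t -> s != t.
  by apply: contraTneq => ->; rewrite edge_irrefl.
by rewrite (edge_neq _ _ uv) (edge_neq _ _ xy) !neq.
Qed.

(** The walk has at least one edge: [drawn_on U] consists of curves only, so the image of a vertex
    belongs to it only as the end of an edge inside [U]. *)
Lemma walk_chain e (U : {set G}) x y s : 0 < e -> path (@edge G) x (y :: s) ->
  {subset x :: y :: s <= U} -> chain e (drawn_on U) (p x) (p (last y s)).
Proof.
move=> e0; elim: s x y => [|z s IH] x y /= /andP[xy ys] sU; last first.
  have ysU : {subset [:: y, z & s] <= U}.
    by move=> w wi; apply: sU; rewrite inE wi orbT.
  apply: chain_cat (IH _ _ ys ysU).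
  have [_ conn Ex Ey] := edge_curve xy.
  apply: chain_sub (connected_chain e0 conn Ex Ey) => a Ea.
  by exists x, y; rewrite xy !sU ?inE ?eqxx ?orbT.
have [_ conn Ex Ey] := edge_curve xy.
apply: chain_sub (connected_chain e0 conn Ex Ey) => a Ea.
by exists x, y; rewrite xy !sU ?inE ?eqxx ?orbT.
Qed.
End Drawing.

(** * Minors of planar graphs *)

Section Walks.
Import Defs.

Definition edge_in (G : sgraph) (U : {set G}) : rel G :=
  fun x y => [&& x \in U, y \in U & edge x y].

Definition walk_connected (G : sgraph) (U : {set G}) :=
  {in U &, forall x y, connect (edge_in U) x y}.

Lemma connect_edge_in_sym (G : sgraph) (U : {set G}) :
  connect_sym (edge_in U).
Proof.
by apply: sym_connect_sym => x y; rewrite /edge_in edge_sym andbCA.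
Qed.

Lemma walk_connected1 (G : sgraph) (x : G) : walk_connected [set x]%SET.
Proof. by move=> y z /set1P-> /set1P->. Qed.

Lemma connect_edge_inP (G : sgraph) (U : {set G}) x y :
  connect (edge_in U) x y ->
  exists s, [/\ path (@edge G) x s, last x s = y & {subset s <= U}].
Proof.
case/connectP=> s xs ->; exists s; split=> //.
  by apply: sub_path xs => ? ? /and3P[].
elim: s x xs => [|z s IH] x //= /andP[/and3P[_ zU _] /IH sU] w.
by rewrite inE => /orP[/eqP->|/sU].
Qed.
End Walks.

Section Minor.
Import all_order all_algebra all_classical all_reals all_analysis Defs.
Import Order.TTheory GRing.Theory Num.Theory.
Import numFieldNormedType.Exports.
Variables (R : realType) (G : sgraph).
Hypothesis G_planar : planar R G.
Variables (n : nat) (K : rel nat) (B : nat -> {set G}).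
Hypothesis B_conn : forall u, u < n ->
  (exists x, x \in B u) /\ walk_connected (B u).
Hypothesis B_disj : forall u v, u < n -> v < n -> u != v ->
  {in B u, forall x, x \notin B v}.
Hypothesis B_adj : forall u v, K u v -> [/\ u < n, v < n, u != v &
  exists x y, [/\ x \in B u, y \in B v & edge x y]].

(** The walk goes through [B u], crosses an edge to [B v] and continues there. It is produced in the
    nonempty form that [walk_chain] expects. *)
Lemma branch_walk u v x y : K u v -> x \in B u -> y \in B v ->
  exists z s, [/\ path (@edge G) x (z :: s), last z s = y
    & {subset x :: z :: s <= (B u :|: B v)%SET}].
Proof.
move=> /B_adj[un vn _ [x' [y' [xu yv xy']]]] xin yin.
have [s [xs xl sU]] := connect_edge_inP ((B_conn un).2 x x' xin xu).
have [t [yt yl tU]] := connect_edge_inP ((B_conn vn).2 y' y yv yin).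
have walk : path (@edge G) x (s ++ y' :: t) by rewrite cat_path xs /= xl xy' yt.
have sub : {subset x :: (s ++ y' :: t) <= (B u :|: B v)%SET}.
  move=> w; rewrite !inE mem_cat inE.
  by case/or4P=> [/eqP->|/sU->|/eqP->|/tU->]; rewrite ?xin ?yv ?orbT.
have lst : last x (s ++ y' :: t) = y by rewrite last_cat /=.
case stE: (s ++ y' :: t) walk sub lst => [|z w]; first by case: (s) stE.
by move=> walk sub lst; exists z, w.
Qed.

(** A branch set is represented by the image of one of its vertices, and an edge [u v] of [K] by a
    fine chain inside the drawing of [B u :|: B v]. Then [r u v w] is the parity of the crossings of
    this chain with the right ray from the representative of [w], and [h] compares heights. *)
Lemma minor_parity :
  exists (r : nat -> nat -> nat -> bool) (h : rel nat),
  (forall a b, a < n -> b < n -> a != b -> h b a = ~~ h a b) /\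
  (forall a b c d, K a b -> K c d -> uniq [:: a; b; c; d] ->
     r a b c (+) r a b d (+) r c d a (+) r c d b
       (+) h a c (+) h a d (+) h b c (+) h b d = false).
Proof.
have [p [E drawn]] := G_planar; have [p_inj _ _ _ _] := drawn.
have [e e0 eP] := curves_apart drawn.
(* The origin is a dummy value for indices outside the minor, so that [choice] yields a total
   function. *)
have /choice[z zP] u : exists z, u < n -> exists2 x, x \in B u & z = p x.
  have [/B_conn[[x xu] _]|_] := ltnP u n; last by exists (0, 0)%R.
  by exists (p x) => _; exists x.
have /choice[Q QP] (i : nat * nat) : exists s : seq (R * R), K i.1 i.2 ->
    [/\ path (nearby e) (z i.1) s, last (z i.1) s = z i.2 &
      forall x, x \in z i.1 :: s -> drawn_on E (B i.1 :|: B i.2)%SET x].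
  have [Ki|_] := boolP (K i.1 i.2); last by exists [::].
  have [/zP[x xu ->] /zP[y yv ->] _ _] := B_adj Ki.
  have [w [s [ws wl sU]]] := branch_walk Ki xu yv.
  by have [t tP] := walk_chain drawn e0 ws sU; exists t => _; rewrite -wl.
pose h := @below R; pose X := @right_of R.
exists (fun u v w => ray h X (z u) (Q (u, v)) (z w)), (fun u v => h (z u) (z v)).
split=> [a b an bn ab|a b c d Kab Kcd U].
  have [x xa ->] := zP _ an; have [y yb ->] := zP _ bn.
  apply: below_anti; apply: contraTneq yb => /p_inj<-; exact: (B_disj an bn ab).
have [abP abl abS] := QP (a, b) Kab; have [cdP cdl cdS] := QP (c, d) Kcd.
have [an bn _ _] := B_adj Kab; have [cn dn _ _] := B_adj Kcd.
have disj : {in (B a :|: B b)%SET, forall x, x \notin (B c :|: B d)%SET}.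
  move: U; rewrite /= !inE !negb_or => /and4P[/and3P[_ ac ad] /andP[bc bd] _ _].
  move=> x; rewrite !inE negb_or.
  by case/orP=> xin; apply/andP; split; apply: B_disj xin.
have far : {in z a :: Q (a, b) & z c :: Q (c, d), forall x y, apart e x y}.
  by move=> x y /abS xS /cdS yS; apply: (drawn_on_apart eP disj xS yS).
have := independent_walks (@below_anti R) (@right_of_anti R)
  (@nearby_apart R e) (apart_irr e0) abP cdP far.
by rewrite abl cdl.
Qed.
End Minor.

Section Kuratowski.
Import Defs.
Variables (R : realType) (G : sgraph).
Hypothesis G_planar : planar R G.
Variable B : nat -> {set G}.

Lemma no_K5_minor :
  (forall u, u < 5 -> (exists x, x \in B u) /\ walk_connected (B u)) ->
  (forall u v, u < v < 5 -> {in B u, forall x, x \notin B v}) ->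
  (forall u v, u < v < 5 -> exists x y, [/\ x \in B u, y \in B v & edge x y]) ->
  False.
Proof.
move=> conn disj adj.
(* Each edge is kept in its increasing orientation only, the one in which [K5_parity] sums the
   relations. *)
have [||r [h [h_anti E]]] :=
  @minor_parity R G G_planar 5 (fun u v => u < v < 5) B conn.
- move=> u v u5 v5; rewrite neq_ltn.
  case/orP=> [uv|vu]; first by apply: disj; rewrite uv.
  move=> x xu; apply/negP => xv; have := disj v u _ x xv.
  by rewrite vu u5 xu => /(_ isT).
- move=> u v uv; have /andP[uv' v5] := uv.
  by split; [exact: ltn_trans v5 | | rewrite ltn_eqF | exact: adj].
by apply: (K5_parity h_anti) => a b c d /and3P[]; apply: E.
Qed.

Lemma no_K33_minor :
  (forall u, u < 6 -> (exists x, x \in B u) /\ walk_connected (B u)) ->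
  (forall u v, u < v < 6 -> {in B u, forall x, x \notin B v}) ->
  (forall u v, u < 3 <= v -> v < 6 ->
    exists x y, [/\ x \in B u, y \in B v & edge x y]) ->
  False.
Proof.
move=> conn disj adj.
have [||r [h [h_anti E]]] :=
  @minor_parity R G G_planar 6 (fun u v => (u < 3 <= v) && (v < 6)) B conn.
- move=> u v u5 v5; rewrite neq_ltn.
  case/orP=> [uv|vu]; first by apply: disj; rewrite uv.
  move=> x xu; apply/negP => xv; have := disj v u _ x xv.
  by rewrite vu u5 xu => /(_ isT).
- move=> u v /andP[uv v6]; have /andP[u3 v3] := uv.
  have uv' := leq_trans u3 v3.
  by split; [exact: ltn_trans v6 | | rewrite ltn_eqF | exact: adj].
apply: (K33_parity h_anti) => a b c d /and5P[ab b6 cd d6].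
by apply: E; rewrite ?ab ?cd.
Qed.
End Kuratowski.

(** * Strong in-dominating classes *)

Lemma connect_exit (T : finType) (e : rel T) (a : pred T) x y :
  connect e x y -> a x -> ~~ a y -> exists u v, [/\ a u, ~~ a v & e u v].
Proof.
case/connectP=> s + ->; elim: s x => [|z s IH] x /=; first by move=> _ ->.
case/andP=> xz zs ax nay; have [az|naz] := boolP (a z); first exact: IH zs az nay.
by exists x, z.
Qed.

Lemma longest_path (T : finType) (e : rel T) :
  exists2 t : seq T, uniq t && sorted e t &
    forall s, uniq s && sorted e s -> size s <= size t.
Proof.
pose P n := [exists t : n.-tuple T, uniq t && sorted e t].
have P0 : exists n, P n by exists 0; apply/existsP; exists [tuple].
have Pmax n : P n -> n <= #|T|.
  case/existsP=> t /andP[/card_uniqP tn _].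
  by rewrite -(size_tuple t) -tn max_card.
case: (ex_maxnP P0 Pmax) => n /existsP[t tP] nmax; exists t => // s sP.
by rewrite size_tuple; apply: nmax; apply/existsP; exists (in_tuple s).
Qed.

Section Classes.
Import Defs.
Variables (R : realType) (D : digraph).
Hypothesis D_planar : planar_digraph R D.
Let G := underlying D.

Lemma arc_edge (x y : D) : arc x y -> @edge G x y.
Proof. by move=> xy; rewrite /= /underlying_edge xy. Qed.

Lemma strong_walk_connected (U : {set D}) :
  strong (induced U) -> @walk_connected G U.
Proof.
move=> /forallP sU x y xU yU.
have /forallP/(_ (Sub y yU))/connectP[s] := sU (Sub x xU).
rewrite -[x in connect _ x]/(val (Sub x xU : induced U)).
move: (Sub x xU : induced U) => u us yE.
have -> : y = val (last u s) by rewrite -yE.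
elim: s u us {yE} => //= v s IH u /andP[uv /IH]; apply: connect_trans.
apply/connect1/and3P.
by split; [exact: (valP u) | exact: (valP v) | exact: arc_edge].
Qed.

Variables U V W : {set D}.
Hypotheses (U_sid : strong_in_dominating U) (V_sid : strong_in_dominating V)
  (W_sid : strong_in_dominating W).
Hypotheses (UV : {in U, forall x, x \notin V}) (UW : {in U, forall x, x \notin W})
  (VW : {in V, forall x, x \notin W}).
Hypotheses (U0 : exists x, x \in U) (V0 : exists x, x \in V)
  (W0 : exists x, x \in W).

Lemma dominated (X Y : {set D}) : strong_in_dominating Y ->
  {in X, forall x, x \notin Y} ->
  {in X, forall x, exists2 y, y \in Y & @edge G x y}.
Proof.
move=> /andP[/forallP domY _] XY x /XY xY.
have /implyP/(_ xY)/existsP[y /andP[yY xy]] := domY x.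
by exists y => //; apply: arc_edge.
Qed.

Let conn (X : {set D}) : strong_in_dominating X -> @walk_connected G X.
Proof. by case/andP=> _ /strong_walk_connected. Qed.

Let e_sym (x y : D) : @edge G x y -> @edge G y x.
Proof. by rewrite edge_sym. Qed.

Let adj (X Y Z : {set D}) :
  {in X, forall x, exists2 y, y \in Y & @edge G x y} ->
  Z \subset X -> (exists z, z \in Z) ->
  exists x y, [/\ x \in Z, y \in Y & @edge G x y].
Proof.
move=> XY /subsetP ZX [z zZ]; have [y yY zy] := XY z (ZX z zZ).
by exists z, y.
Qed.

Let adjC (X Y Z : {set D}) :
  {in X, forall x, exists2 y, y \in Y & @edge G x y} ->
  Z \subset X -> (exists z, z \in Z) ->
  exists x y, [/\ x \in Y, y \in Z & @edge G x y].
Proof.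
by move=> XY ZX /(adj XY ZX)[x [y [xZ yY /e_sym yx]]]; exists y, x.
Qed.

Let set1_notin (X : {set D}) x : {in U, forall w, w \notin X} -> x \in U ->
  {in [set x], forall w, w \notin X}.
Proof. by move=> UX xU w /set1P->; apply: UX. Qed.

Let notin_set1 (X : {set D}) x : {in U, forall w, w \notin X} -> x \in U ->
  {in X, forall w, w \notin [set x]}.
Proof.
by move=> UX xU w wX; rewrite inE; apply: contraTneq wX => ->; apply: UX.
Qed.

Let set1_disj (x y : D) : x != y -> {in [set x], forall w, w \notin [set y]}.
Proof. by move=> xy w /set1P->; rewrite inE. Qed.

(** One side of the K33 is [[set c]], [V], [W] and the other is the three leaves. The centre sees
    the leaves by assumption, and in-domination gives every leaf a neighbour in [V] and one in
    [W]. *)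
Lemma no_claw c x y z : c \in U -> x \in U -> y \in U -> z \in U ->
  uniq [:: x; y; z] -> @edge G c x -> @edge G c y -> @edge G c z -> False.
Proof.
move=> cU xU yU zU Uxyz cx cy cz.
have ne a b : @edge G a b -> a != b.
  by apply: contraTneq => ->; rewrite edge_irrefl.
have [dV dW] := (dominated V_sid UV, dominated W_sid UW).
apply: (@no_K33_minor R G D_planar
  (nth set0 [:: [set c]; V; W; [set x]; [set y]; [set z]])).
- have sing (a : D) : (exists b, b \in [set a]) /\ @walk_connected G [set a].
    by split; [exists a; rewrite inE | exact: walk_connected1].
  by case=> [|[|[|[|[|[|]]]]]] //= _; split=> //; exact: conn.
- move: Uxyz; rewrite /= !inE negb_or => /and3P[/andP[xy xz] yz _].
  case=> [|[|[|[|[|[|u]]]]]] [|[|[|[|[|[|v]]]]]] //= _;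
    do ?[exact: VW | exact: set1_notin | exact: notin_set1]; try exact: set1_disj;
    by [move=> w _; rewrite nth_nil inE | apply: set1_disj; rewrite // ne].
- have sub (a : D) : a \in U -> [set a] \subset U by rewrite sub1set.
  have ex (a : D) : exists b, b \in [set a] by exists a; rewrite inE.
  case=> [|[|[|u]]] [|[|[|[|[|[|v]]]]]] //= _ _;
    do ?[by apply: adjC (sub _ _) (ex _)].
  - by exists c, x; split; rewrite ?set11.
  - by exists c, y; split; rewrite ?set11.
  - by exists c, z; split; rewrite ?set11.
Qed.

(** A cycle is cut into the edge [x y] and the connected rest [P], three mutually adjacent branch
    sets. [V] and [W] complete them to a K5, their own adjacency coming from the in-domination of
    [W]. *)
Lemma no_cycle x y (P : {set D}) : x \in U -> y \in U -> P \subset U ->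
  x \notin P -> y \notin P -> @walk_connected G P -> @edge G x y ->
  (exists2 p, p \in P & @edge G x p) ->
  (exists2 p, p \in P & @edge G y p) -> False.
Proof.
move=> xU yU /[dup] PU /subsetP PU' xP yP Pconn xy [p pP xp] [q qP yq].
have ne a b : @edge G a b -> a != b.
  by apply: contraTneq => ->; rewrite edge_irrefl.
have [dV dW] := (dominated V_sid UV, dominated W_sid UW).
have dVW := dominated W_sid VW.
apply: (@no_K5_minor R G D_planar (nth set0 [:: [set x]; [set y]; P; V; W])).
- have sing (a : D) : (exists b, b \in [set a]) /\ @walk_connected G [set a].
    by split; [exists a; rewrite inE | exact: walk_connected1].
  case=> [|[|[|[|[|]]]]] //= _; split=> //; [by exists p | exact: conn..].
- have PV : {in P, forall w, w \notin V} by move=> w /PU'/UV.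
  have PW : {in P, forall w, w \notin W} by move=> w /PU'/UW.
  have xP1 : {in [set x], forall w, w \notin P} by move=> w /set1P->.
  have yP1 : {in [set y], forall w, w \notin P} by move=> w /set1P->.
  case=> [|[|[|[|[|u]]]]] [|[|[|[|[|v]]]]] //= _; do ?[exact: VW];
    do ?[exact: set1_notin | exact: set1_disj (ne _ _ xy)];
    by move=> w _; rewrite nth_nil inE.
- have sub (a : D) : a \in U -> [set a] \subset U by rewrite sub1set.
  have ex (a : D) : exists b, b \in [set a] by exists a; rewrite inE.
  have P0 : exists p, p \in P by exists p.
  case=> [|[|[|[|[|u]]]]] [|[|[|[|[|v]]]]] //= uv; try by case/andP: uv.
    all: do ?[exact: adj (sub _ _) (ex _)]; do ?[exact: adj PU P0];
      do ?[exact: adj dVW _ V0].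
  - by exists x, y; split; rewrite ?set11.
  - by exists x, p; split; rewrite ?set11.
  - by exists y, q; split; rewrite ?set11.
Qed.

(* A longest path of U is spanning by [no_claw] and induced by [no_cycle]; the
   arcs between consecutive vertices then exist in both directions because the
   cut between them has no other arc. *)
Lemma class_symmetric_path : symmetric_path (induced U).
Proof.
pose T := induced U; pose e : rel T := @edge (underlying T).
have e_symT : symmetric e by move=> x y; apply: (@edge_sym (underlying T)).
have [t /andP[Ut et] tmax] := longest_path e.
have /forallP arc_conn : strong T by case/andP: U_sid.
have e_arc (x y : T) : arc x y -> e x y by move=> xy; apply/orP; left.
have e_conn x y : connect e x y.
  have /forallP/(_ y) := arc_conn x.
  by apply: connect_sub => u v /e_arc/connect1.
have [x0 _] : exists x : T, true by case: U0 => x xU; exists (Sub x xU).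
have t0 : 0 < size t by apply: (tmax [:: x0]).
have next i : i.+1 < size t -> e (nth x0 t i) (nth x0 t i.+1).
  by move/(sortedP x0): et; apply.
have nthU i : val (nth x0 t i) \in U by exact: valP.
have nth_eq i j : i < size t -> j < size t ->
    (val (nth x0 t i) == val (nth x0 t j)) = (i == j).
  by move=> it jt; rewrite (inj_eq val_inj) nth_uniq.
have cover x : x \in t.
  apply: contraT => xt.
  have [u [v [ut vt uv]]] :=
    connect_exit (a := mem t) (e_conn (nth x0 t 0) x) (mem_nth x0 t0) xt.
  have {ut} [i it uE] : exists2 i, i < size t & u = nth x0 t i.
    by exists (index u t); rewrite ?index_mem ?nth_index.
  (* A missed vertex [v] next to the first or the last vertex of [t] would lengthen [t]; next to an
     inner vertex, it forms a claw with the two path neighbours of that vertex. *)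
  subst u; case: i it uv => [|i] it uv.
    have /tmax : uniq (v :: t) && sorted e (v :: t).
      rewrite cons_uniq vt Ut.
      apply/(sortedP x0) => -[|k] /= kt; last exact: next.
      by rewrite e_symT.
    by rewrite ltnn.
  have [it'|ti] := ltnP i.+2 (size t); last first.
    have tE : i.+2 = size t by apply/eqP; rewrite eqn_leq it.
    have /tmax : uniq (rcons t v) && sorted e (rcons t v).
      rewrite rcons_uniq vt Ut.
      apply/(sortedP x0) => k; rewrite size_rcons ltnS => kt.
      rewrite !nth_rcons kt.
      have [kt'|tk] := ltnP k.+1 (size t); first exact: next.
      have kE : k.+1 = size t by apply/eqP; rewrite eqn_leq kt.
      by rewrite kE eqxx; have -> : k = i.+1 by apply: succn_inj; rewrite kE.
    by rewrite size_rcons ltnn.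
  exfalso; apply: (@no_claw (val (nth x0 t i.+1)) (val (nth x0 t i))
    (val (nth x0 t i.+2)) (val v)).
  all: try by []; try exact: (valP v).
  - have vt' k : k < size t -> val (nth x0 t k) != val v.
      by move=> kt; apply: contraNneq vt => /val_inj<-; exact: mem_nth.
    rewrite /= !inE negb_or nth_eq ?vt' ?andbT ?ltn_eqF //;
      exact: ltnW (ltnW it').
  - by apply: e_sym; apply: next.
  - exact: next.
have chord i j : i < j < size t -> e (nth x0 t i) (nth x0 t j) -> j = i.+1.
  move=> /andP[ij jt] eij; apply/eqP.
  rewrite eqn_leq ij andbT leqNgt; apply/negP => ij'.
  (* The stretch of [t] strictly between the ends of the chord closes a cycle with it. Since
     [i.+1 < j], it contains the vertices of index [i.+1] and [j.-1], which are the neighbours of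
     the two ends. *)
  pose P := [set val (nth x0 t (k : 'I_(size t))) | k : 'I_(size t) & i < k < j].
  have inP k : i < k < j -> val (nth x0 t k) \in P.
    move=> /andP[ik kj]; apply/imsetP.
    by exists (Ordinal (ltn_trans kj jt)); rewrite ?inE //= ik.
  have it := ltn_trans ij jt.
  have walk k d : i < k -> k + d < j ->
      connect (@edge_in G P) (val (nth x0 t k)) (val (nth x0 t (k + d))).
    move=> ik; elim: d => [|d IH]; first by rewrite addn0.
    rewrite addnS => kdj; apply: connect_trans (IH (ltnW kdj)) _; apply: connect1.
    have ikd : i < k + d by apply: leq_trans ik (leq_addr _ _).
    apply/and3P; split; first by rewrite inP // ikd ltnW.
      by rewrite inP // kdj ltnW.
    by apply: next; apply: ltn_trans jt.
  apply: (@no_cycle (val (nth x0 t i)) (val (nth x0 t j)) P); try exact: nthU.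
  - by apply/subsetP => _ /imsetP[k _ ->].
  - apply/negP => /imsetP[k]; rewrite inE => /andP[ik _] /eqP.
    by rewrite nth_eq // ltn_eqF.
  - apply/negP => /imsetP[k]; rewrite inE => /andP[_ kj] /eqP.
    by rewrite nth_eq // gtn_eqF.
  - move=> _ _ /imsetP[k + ->] /imsetP[l + ->].
    rewrite !inE => /andP[ik kj] /andP[il lj].
    have [kl|/ltnW lk] := leqP k l.
      by rewrite -(subnKC kl) walk // subnKC.
    by rewrite connect_edge_in_sym -(subnKC lk) walk // subnKC.
  - exact: eij.
  - exists (val (nth x0 t i.+1)); first by rewrite inP // ltnSn.
    by apply: next; apply: ltn_trans jt.
  - have jE : j.-1.+1 = j by rewrite prednK // (leq_trans _ ij).
    exists (val (nth x0 t j.-1)).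
      by apply: inP; rewrite -(ltnS i.+1) jE ij' leqnn.
    by apply: e_sym; rewrite -{2}jE; apply: next; rewrite jE.
have nth_ix x : nth x0 t (index x t) = x by rewrite nth_index.
have ix x : index x t < size t by rewrite index_mem.
have ix_edge x y : e x y -> index x t < index y t -> index y t = (index x t).+1.
  by move=> xy lt_xy; apply: chord; rewrite ?lt_xy ?ix ?nth_ix.
have arc_next i : i.+1 < size t -> arc (nth x0 t i) (nth x0 t i.+1) /\
    arc (nth x0 t i.+1) (nth x0 t i).
  move=> it; have it' := ltnW it; split.
  - have /forallP/(_ (nth x0 t i.+1)) conn_i := arc_conn (nth x0 t i).
    have [||u [v [/= ui vi uv]]] :=
      connect_exit (a := fun x => index x t <= i) conn_i;
      rewrite ?index_uniq ?ltnn //.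
    rewrite -ltnNge in vi.
    have uvE := ix_edge u v (e_arc u v uv) (leq_ltn_trans ui vi).
    have ui' : index u t = i by apply/eqP; rewrite eqn_leq ui -ltnS -uvE.
    by rewrite -ui' -uvE !nth_ix.
  - have /forallP/(_ (nth x0 t i)) conn_i := arc_conn (nth x0 t i.+1).
    have [||u [v [/= ui vi uv]]] :=
      connect_exit (a := fun x => i < index x t) conn_i;
      rewrite ?index_uniq ?ltnn //.
    rewrite -leqNgt in vi.
    have vu : e v u by rewrite e_symT e_arc.
    have uvE := ix_edge v u vu (leq_ltn_trans vi ui).
    have vi' : index v t = i by apply/eqP; rewrite eqn_leq vi -ltnS -uvE.
    by rewrite -vi' -uvE !nth_ix.
case tE: (size t) t0 => [|n] // _; exists n.
have ltn x : index x t < n.+1 by rewrite -tE.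
exists (fun x => Ordinal (ltn x)).
  exists (fun i : 'I_n.+1 => nth x0 t i) => [x|i] /=; first exact: nth_ix.
  by apply: val_inj; rewrite /= index_uniq // tE.
move=> x y; rewrite /= /path_edge /=; apply/idP/idP => [|xy].
  by case/orP=> /eqP xy; rewrite -(nth_ix x) -(nth_ix y) -xy;
    have [] := arc_next _ (eq_ind_r (fun k => k < size t) (ix _) xy).
have [xy'|yx'|/(congr1 (nth x0 t))] := ltngtP (index x t) (index y t).
- by rewrite (ix_edge x y) ?eqxx // e_arc.
- by rewrite (ix_edge y x) ?eqxx ?orbT // e_symT e_arc.
- by rewrite !nth_ix => xE; case/negP: (negbT (@arc_irrefl T y)); rewrite -{1}xE.
Qed.
End Classes.

Theorem theorem6 (R : realType) (D : digraph)
  (D_planar : planar_digraph R D) (D_strong : strong D)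
  (D_ds : ds_in D = 3)
  (S : 'I_3 -> {set D}) (S_inj : injective S)
  (S_part : strong_in_dominating_partition [set S i | i : 'I_3]) :
  forall i : 'I_3, symmetric_path (induced (S i)).
Proof.
move=> i; case/andP: S_part => /and3P[_ /trivIsetP S_triv S_n0] /forallP S_sid.
have inS j : S j \in [set S i | i : 'I_3] by exact: imset_f.
have sid j : strong_in_dominating (S j) by have /implyP := S_sid (S j); apply.
(* Injectivity of [S] turns distinct indices into distinct classes of the partition. *)
have disj j k : j != k -> {in S j, forall x, x \notin S k}.
  move=> jk x xj; rewrite (disjointFr _ xj) //; apply: S_triv => //.
  by rewrite (inj_eq S_inj).
have ne j : exists x, x \in S j.
  by apply/set0Pn; apply: contraNneq S_n0 => <-.
have [j [k [ij ik jk]]] : exists j k : 'I_3, [/\ i != j, i != k & j != k].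
  case: i => -[|[|[|i]]] // lti.
  - by exists (inord 1), (inord 2); rewrite -!val_eqE /= !inordK.
  - by exists (inord 0), (inord 2); rewrite -!val_eqE /= !inordK.
  - by exists (inord 0), (inord 1); rewrite -!val_eqE /= !inordK.
exact: (class_symmetric_path D_planar (sid i) (sid j) (sid k) (disj _ _ ij)
  (disj _ _ ik) (disj _ _ jk)).
Qed.
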